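(* For all positive integers $n$, the number $2^{4n}\mathbf a_n$ is an integer, where $$ \mathbf a_n=4(-1)^{n-1}\sum_{j=0}^{n}\frac{\partial}{\partial\varepsilon}\Bigg(\Big(\frac n2-j+\varepsilon\Big)\Big(\frac{n!}{(1-\varepsilon)_j\,(1+\varepsilon)_{n-j}}\Big)^3\binom{n+j-\varepsilon-\frac12}{n}\binom{2n-j+\varepsilon-\frac12}{n}\Bigg)\Bigg|_{\varepsilon=0}. $$
   Context: The Pochhammer symbol is $(\alpha)_k=\alpha(\alpha+1)\cdots(\alpha+k-1)$ for integers $k\ge1$, and $(\alpha)_0=1$. For a non-negative integer $m$ and real $x$, $\binom{x}{m}=\frac{x(x-1)\cdots(x-m+1)}{m!}$. Origin of $\mathbf a_n$: with Catalan's constant $G=\sum_{k=1}^\infty\frac{(-1)^{k-1}}{(2k-1)^2}$ and $$\mathbf G_n=n!\sum_{k=1}^{\infty}(-1)^k\Big(k+\frac{n-1}{2}\Big)\frac{(k-n)_n(k+n)_n}{\left(k-\frac12\right)_{n+1}^3},$$ a partial fraction decomposition of the summand with respect to $k$ gives $\mathbf G_n=\mathbf a_nG-\mathbf b_n$ with $\mathbf a_n$ given by the explicit formula in the claim (and $\mathbf b_n$ an explicit rational number); the explicit formula is to be taken as the definition of $\mathbf a_n$. *)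

(* Defs.v *)
From mathcomp Require Import all_boot all_order all_algebra.
From mathcomp Require Import reals topology normedtype derive.

Set Implicit Arguments.
Unset Strict Implicit.
Unset Printing Implicit Defensive.

Import Order.TTheory GRing.Theory Num.Theory.
Import numFieldNormedType.Exports.

Local Open Scope classical_set_scope.
Local Open Scope ring_scope.

Definition pochhammer (R : realType) (a : R) (k : nat) : R :=
  \prod_(i < k) (a + i%:R).

Definition gbinom (R : realType) (x : R) (m : nat) : R :=
  (\prod_(i < m) (x - i%:R)) / (m`!)%:R.

Definition catalan_term (R : realType) (n j : nat) (eps : R) : R :=
  (n%:R / 2 - j%:R + eps)
  * ((n`!)%:R / (pochhammer (1 - eps) j * pochhammer (1 + eps) (n - j))) ^+ 3
  * gbinom (n%:R + j%:R - eps - 1 / 2) n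
  * gbinom (2 * n%:R - j%:R + eps - 1 / 2) n.

(* Each summand is a rational function of eps whose denominator at eps = 0 is
   a product of factorials and powers of 2, hence nonzero, so that the total
   operator derive1 returns a genuine derivative here. *)
Definition catalan_a (R : realType) (n : nat) : R :=
  4 * (-1) ^+ n.-1 * \sum_(j < n.+1) derive1 (@catalan_term R n j) 0.

(* Main.v *)
(* Put x = j - eps. The product of the two half-integer binomials is a
   polynomial in x (n - x), and Saalschuetz's theorem gives its expansion in the
   Newton basis prod_(i < k) (x - i) (n - x - i). For each basis element the
   remaining sum over j is, to first order in eps, a bilateral well-poised sum
   of Dougall type: passing from k to k + 1 multiplies it by (n - k)^2, by a
   telescoping whose boundary terms are O(eps^2), and at k = n only j = 0 and
   j = n contribute. This yields
     a_n = -4 sum_k binom(n, k) (k + 1/2)_(2(n-k)) / (n-k)!^2,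
   a sum without derivatives, and 4^m (k + 1/2)_m / m! is an integer. *)
Require Import Defs.
From mathcomp Require Import all_boot all_order all_algebra.
From mathcomp Require Import boolp classical_sets functions.
From mathcomp Require Import reals topology normedtype derive.
From mathcomp Require Import ring lra.

Import Order.TTheory GRing.Theory Num.Theory.
Import numFieldNormedType.Exports.

Local Open Scope ring_scope.

(** * Rising factorials, Newton products and half-integer integrality *)

Section Pochhammer.
Variable R : realType.
Implicit Types (a x s N : R) (m n k d : nat).

Lemma pochhammer0 a : pochhammer a 0 = 1.
Proof. exact: big_ord0. Qed.

Lemma pochhammerSr a k : pochhammer a k.+1 = pochhammer a k * (a + k%:R).
Proof. exact: big_ord_recr. Qed.

Lemma pochhammerD a k d :
  pochhammer a (k + d) = pochhammer a k * pochhammer (a + k%:R) d.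
Proof.
elim: d => [|d IH]; first by rewrite addn0 pochhammer0 mulr1.
by rewrite addnS !pochhammerSr IH natrD addrA mulrA.
Qed.

Lemma pochhammerSl a k : pochhammer a k.+1 = a * pochhammer (a + 1) k.
Proof. by rewrite -add1n pochhammerD pochhammerSr pochhammer0 mul1r addr0. Qed.

Lemma gbinom_pochhammer a m : gbinom (a + m%:R - 1) m = pochhammer a m / m`!%:R.
Proof.
rewrite /gbinom /pochhammer (reindex_inj rev_ord_inj) /=; congr (_ / _).
by apply: eq_bigr => i _; rewrite natrB // -natr1; ring.
Qed.

Lemma pochhammer_gt0 a k : 0 < a -> 0 < pochhammer a k.
Proof. by move=> a_gt0; apply: prodr_gt0 => i _; rewrite ltr_wpDr. Qed.

Lemma pochhammer1 k : pochhammer (1 : R) k = k`!%:R.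
Proof.
elim: k => [|k IH]; first by rewrite pochhammer0.
by rewrite pochhammerSr IH factS natrM -natr1 mulrC [1 + _]addrC.
Qed.

(** Each factor equals x (N - x) - i (N - i), so these are the Newton basis polynomials in x (N - x)
    with nodes i (N - i). *)
Definition newton N k x : R := \prod_(i < k) ((x - i%:R) * (N - x - i%:R)).

Lemma newtonS N k x :
  newton N k.+1 x = newton N k x * ((x - k%:R) * (N - x - k%:R)).
Proof. exact: big_ord_recr. Qed.

Lemma newton_refl N k x : newton N k (N - x) = newton N k x.
Proof. by apply: eq_bigr => i _; ring. Qed.

(** Under x -> x + 1 each of the two products changes only in its extreme factors. The ratio is
    cross-multiplied so that it also holds where a factor vanishes. *)
Lemma newton_shift N k x :
  newton N k (x + 1) * (x + 1 - k%:R) * (N - x) =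
  (x + 1) * (N - x - k%:R) * newton N k x.
Proof.
elim: k => [|k IH]; first by rewrite /newton !big_ord0; ring.
rewrite !newtonS -natr1.
transitivity (newton N k (x + 1) * (x + 1 - k%:R) * (N - x) *
  ((N - x - 1 - k%:R) * (x - k%:R))); first by ring.
by rewrite IH; ring.
Qed.

(* Saalschuetz's theorem, read as a Newton expansion in the variable
   x * (N - x). *)
Lemma pochhammer_newton N s m x :
  pochhammer (x + s) m * pochhammer (N - x + s) m =
  \sum_(k < m.+1) 'C(m, k)%:R * pochhammer (s + k%:R) (m - k)
    * pochhammer (N + s) (m - k) * newton N k x.
Proof.
elim: m => [|m IH].
  rewrite big_ord_recr big_ord0 /= /newton big_ord0 subnn bin0 !pochhammer0.
  by ring.
pose c m k : R := 'C(m, k)%:R * pochhammer (s + k%:R) (m - k)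
    * pochhammer (N + s) (m - k).
(* [b k] is (x + s + m) (N - x + s + m) - (x - k) (N - x - k), which is free of x. Multiplying the
   k-th term by the new factor thus feeds the basis elements k and k + 1 only. *)
pose b k := (m%:R + s + k%:R) * (m%:R + s + N - k%:R).
have c0 : c m.+1 0 = b 0 * c m 0.
  rewrite /c /b !subn0 !bin0 !pochhammerSr; ring.
have cS k : (k <= m)%N -> c m.+1 k.+1 = c m k + b k.+1 * c m k.+1.
  rewrite leq_eqVlt /c => /predU1P[->|lt_km].
    rewrite !binn bin_small ?ltnSn // !subnn !pochhammer0.
    by ring.
  have [d def_m] : exists d, m = (k + d).+1.
    by exists (m - k.+1)%N; rewrite -addSn subnKC.
  have d1 : (m.+1 - k.+1 = d.+1)%N by rewrite subSS def_m -addnS addKn.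
  have d2 : (m - k = d.+1)%N by rewrite def_m -addnS addKn.
  have d3 : (m - k.+1 = d)%N by rewrite def_m subSS addKn.
  rewrite d1 d2 d3 binS natrD.
  rewrite [pochhammer (s + k%:R) _]pochhammerSl -addrA natr1 !pochhammerSr /b.
  have /(congr1 (fun i => i%:R : R)) := mul_bin_left m k.
  rewrite d2 !natrM def_m -!natr1 natrD => binE.
  set C1 := 'C(_, k)%:R in binE *; set C2 := 'C(_, _)%:R in binE *.
  set p := pochhammer _ _; set q := pochhammer _ _.
  apply/eqP; rewrite -subr_eq0.
  rewrite (_ : _ - _ = p * q * (N + s + d%:R) *
    ((d%:R + 1) * C1 - (k%:R + 1) * C2)); first by rewrite binE subrr mulr0.
  by ring.
rewrite !pochhammerSr.
transitivity ((\sum_(k < m.+1) c m k * newton N k x) *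
    ((x + s + m%:R) * (N - x + s + m%:R))); first by rewrite -IH; ring.
rewrite -/(c m.+1) mulr_suml.
transitivity (\sum_(k < m.+1) (c m k * newton N k.+1 x +
                               b k * c m k * newton N k x)).
  by apply: eq_bigr => k _; rewrite newtonS /b; ring.
rewrite big_split /= addrC.
transitivity (\sum_(k < m.+2) b k * c m k * newton N k x +
    \sum_(k < m.+1) c m k * newton N k.+1 x).
  congr (_ + _); rewrite [RHS]big_ord_recr /=.
  by rewrite /c bin_small ?ltnSn // !(mul0r, mulr0) addr0.
rewrite big_ord_recl [RHS]big_ord_recl -addrA -big_split /=; congr (_ + _).
  by rewrite -/(c m.+1 0%N) c0.
apply: eq_bigr => k _; rewrite /bump leq0n add1n -/(c m.+1 k.+1) cS ?leq_ord //.
by ring.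
Qed.

(** These are the coefficients of (1 - 4 z)^(-k - 1/2), the generating series of the central
    binomial coefficients times (1 - 4 z)^(-k). *)
Lemma pochhammer_half_int k m :
  4 ^+ m * pochhammer (k%:R + 1 / 2) m / m`!%:R \is a (@Num.int R).
Proof.
have fact_neq0 i : i`!%:R != 0 :> R by rewrite pnatr_eq0 -lt0n fact_gt0.
elim: k m => [|k IHk] m.
  suff -> : 4 ^+ m * pochhammer (0%:R + 1 / 2) m / m`!%:R = 'C(m.*2, m)%:R :> R.
    exact: natr_int.
  elim: m => [|m IH]; first by rewrite pochhammer0 bin0 expr0 fact0 mul1r divr1.
  rewrite doubleS; apply: (@mulfI _ (m.+1%:R)); first by rewrite pnatr_eq0.
  have -> : m.+1%:R * 'C(m.*2.+2, m.+1)%:R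
          = 2 * (2 * m%:R + 1) * 'C(m.*2, m)%:R :> R.
    have := mul_bin_diag m.*2.+2 m; have := mul_bin_down m.*2.+1 m.
    rewrite /= (_ : m.*2.+1 - m = m.+1)%N; last first.
      by rewrite -addnn subSn ?addnK // leq_addr.
    move=> /(congr1 (fun i => i%:R : R)); rewrite !natrM => h1.
    move=> /(congr1 (fun i => i%:R : R)); rewrite !natrM => h2.
    rewrite -h2 -doubleS -mul2n natrM -mulrA -h1.
    by rewrite -[m.*2.+1%:R]natr1 -mul2n natrM; ring.
  rewrite -IH pochhammerSr exprS factS natrM -[m.+1%:R]natr1.
  by field; rewrite natr1 fact_neq0 pnatr_eq0.
elim: m => [|m IHm].
  by rewrite pochhammer0 fact0 expr0 mul1r divr1 int_num1.
(* Coefficient of z^(m + 1) when the series for k + 1 is multiplied by 1 - 4 z to give the series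
   for k. *)
suff -> : 4 ^+ m.+1 * pochhammer (k.+1%:R + 1 / 2) m.+1 / m.+1`!%:R =
   4 ^+ m.+1 * pochhammer (k%:R + 1 / 2) m.+1 / m.+1`!%:R +
   4 * (4 ^+ m * pochhammer (k.+1%:R + 1 / 2) m / m`!%:R) :> R.
  by rewrite rpredD // rpredM // natr_int.
rewrite pochhammerSr [pochhammer (k%:R + _) _]pochhammerSl.
rewrite -[k.+1%:R]natr1 exprS factS natrM -[m.+1%:R]natr1 [k%:R + _ + 1]addrAC.
by field; rewrite natr1 fact_neq0 pnatr_eq0.
Qed.

End Pochhammer.

(** * Derivability, and derivatives at a simple or double zero *)

Section DerivativeAtZero.
Variable R : realType.
Implicit Types (f g h : R -> R) (c : R).

Lemma derivable_prod_ord k (F : 'I_k -> R -> R) (x : R) :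
  (forall i, derivable (F i) x 1) ->
  derivable (fun e => \prod_(i < k) F i e) x 1.
Proof.
elim: k F => [|k IH] F dF.
  rewrite (_ : (fun _ => _) = cst 1); first exact: derivable_cst.
  by apply/funext => e; rewrite big_ord0.
rewrite (_ : (fun _ => _) =
  (fun e => \prod_(i < k) F (widen_ord (leqnSn k) i) e) * F ord_max).
  by apply: derivableM => //; apply: IH.
by apply/funext => e; rewrite big_ord_recr.
Qed.

(** This rule and the next ones are restated for functions written pointwise, the shape of the goals
    met by [derivable_arith]. *)
Lemma derivable_fctD f g (x : R) : derivable f x 1 -> derivable g x 1 ->
  derivable (fun e => f e + g e) x 1.
Proof. exact: derivableD. Qed.

Lemma derivable_fctB f g (x : R) : derivable f x 1 -> derivable g x 1 ->
  derivable (fun e => f e - g e) x 1.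
Proof. exact: derivableB. Qed.

Lemma derivable_fctM f g (x : R) : derivable f x 1 -> derivable g x 1 ->
  derivable (fun e => f e * g e) x 1.
Proof. exact: derivableM. Qed.

Lemma derivable_fctX f k (x : R) : derivable f x 1 ->
  derivable (fun e => f e ^+ k) x 1.
Proof. by move=> df; rewrite -exprfctE; exact: derivableX. Qed.

Lemma derivable_fct_cst c (x : R) : derivable (fun _ => c) x 1.
Proof. exact: derivable_cst. Qed.

Lemma derivable_fct_id (x : R) : derivable (fun e => e) x 1.
Proof. exact: derivable_id. Qed.

(** At a zero, the derivative is the value of the cofactor, so [h] itself never has to be
    differentiated explicitly. *)
Lemma derive1_idM h : derivable h 0 1 -> derive1 (fun e : R => e * h e) 0 = h 0.
Proof.
move=> dh; rewrite derive1E (@deriveM _ _ id h) // derive_id /=.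
by rewrite /GRing.scale /= mul0r add0r mulr1.
Qed.

Lemma derive1_sqrM h : derivable h 0 1 ->
  derive1 (fun e : R => e ^+ 2 * h e) 0 = 0.
Proof.
move=> dh.
rewrite (_ : (fun _ => _) = (fun e => e * (e * h e))); last first.
  by apply/funext => e; rewrite expr2 mulrA.
rewrite derive1_idM ?mul0r //.
by apply: (@derivableM _ _ id h) => //; exact: derivable_id.
Qed.

Lemma derive1_sum k (F : 'I_k -> R -> R) :
  (forall i, derivable (F i) 0 1) ->
  derive1 (fun e => \sum_(i < k) F i e) 0 = \sum_(i < k) derive1 (F i) 0.
Proof.
move=> dF; rewrite derive1E.
rewrite (_ : (fun _ => _) = \sum_(i < k) F i); last first.
  by apply/funext => e; rewrite fct_sumE.
by rewrite derive_sum //; apply: eq_bigr => i _; rewrite derive1E.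
Qed.

Lemma derive1_cstM c f : derivable f 0 1 ->
  derive1 (fun e : R => c * f e) 0 = c * derive1 f 0.
Proof. by move=> df; rewrite !derive1E (@deriveZ _ _ _ f c). Qed.

(** Serves identities that need |e| < 1, where the Pochhammer denominators do not vanish. *)
Lemma near0_derive1 f g : (forall e, -1 < e < 1 -> f e = g e) ->
  derive1 f 0 = derive1 g 0.
Proof.
move=> fg; rewrite !derive1E; apply: near_eq_derive.
near=> e; apply: fg; rewrite -ltr_norml.
near: e; exact: (@nbhs0_lt R R).
Unshelve. all: by end_near. Qed.

End DerivativeAtZero.

(** Structural recursion on the body. Subtraction is matched before addition, since it is a sum with
    an opposite; functions of unknown shape are left as goals. *)
Ltac derivable_arith :=
  cbv beta;
  lazymatch goal with
  | H : derivable ?f _ _ |- derivable ?f _ _ => exact: H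
  | H : derivable ?f _ _ |- derivable (fun e => ?f e) _ _ => exact: H
  | |- derivable (fun e => @?f e + - @?g e) _ _ =>
      apply: (@derivable_fctB _ f g); derivable_arith
  | |- derivable (fun e => @?f e + @?g e) _ _ =>
      apply: (@derivable_fctD _ f g); derivable_arith
  | |- derivable (fun e => @?f e * @?g e) _ _ =>
      apply: (@derivable_fctM _ f g); derivable_arith
  | |- derivable (fun e => @?f e ^+ ?k) _ _ =>
      apply: (@derivable_fctX _ f k); derivable_arith
  | |- derivable (fun _ => \prod_(i < _) _) _ _ =>
      apply: derivable_prod_ord => ?; derivable_arith
  | |- derivable (+%R ?a) _ _ =>
      apply: (@derivable_fctD _ (fun=> a) id); derivable_arith
  | |- derivable ( *%R ?a) _ _ =>
      apply: (@derivable_fctM _ (fun=> a) id); derivable_arith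
  | |- derivable id _ _ => exact: derivable_fct_id
  | |- derivable (fun e => e) _ _ => exact: derivable_fct_id
  | |- derivable (fun _ => ?c) _ _ => exact: derivable_fct_cst
  | |- derivable (fun _ => _) _ _ => idtac
  end.

(** * The well-poised sums attached to the Newton basis *)

Section DougallSum.
Variables (R : realType) (n : nat).
Implicit Types (e : R) (j k : nat).

(** A deformation of the binomial coefficient C(n, j), which is its value at e = 0. *)
Definition weight j e : R :=
  n`!%:R / (pochhammer (1 - e) j * pochhammer (1 + e) (n - j)).

Definition dougall_term k j e : R :=
  (n%:R / 2 - j%:R + e) * weight j e ^+ 3 * newton R n%:R k (j%:R - e).

Lemma derivable_pochhammer (f : R -> R) k : derivable f 0 1 ->
  derivable (fun e => pochhammer (f e) k) 0 1.
Proof. by move=> df; rewrite /pochhammer; derivable_arith. Qed.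

Lemma derivable_newton (N : R) k (f : R -> R) : derivable f 0 1 ->
  derivable (fun e : R => newton R N k (f e)) 0 1.
Proof. by move=> df; rewrite /newton; derivable_arith. Qed.

Lemma derivable_weight j : derivable (weight j) 0 1.
Proof.
apply: derivable_fctM; first exact: derivable_fct_cst.
apply: derivableV.
  by rewrite subr0 addr0 mulf_neq0 // gt_eqF // pochhammer_gt0.
by apply: derivable_fctM; apply: derivable_pochhammer; derivable_arith.
Qed.

Lemma derivable_dougall_term k j : derivable (dougall_term k j) 0 1.
Proof.
have dw := derivable_weight j.
apply: derivable_fctM; last by apply: derivable_newton; derivable_arith.
by derivable_arith.
Qed.

(** Each Pochhammer symbol gains or loses only its last factor; the bounds on [e] make the
    denominators positive. *)
Lemma weight_rec j e : -1 < e < 1 -> (j < n)%N ->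
  weight j.+1 e * (j%:R + 1 - e) = weight j e * (n%:R - j%:R + e).
Proof.
move=> /andP[e_gtN1 e_lt1] lt_jn; rewrite /weight.
have -> : (n - j = (n - j.+1).+1)%N by rewrite -subSn // subSS.
have -> : n%:R = j%:R + 1 + (n - j.+1)%:R :> R.
  by rewrite natr1 -natrD subnKC.
rewrite !pochhammerSr; set d := (n - j.+1)%N.
have := ler0n R d; have := ler0n R j.
set p := pochhammer _ _; set q := pochhammer _ _ => j_ge0 d_ge0.
have p_gt0 : 0 < p by rewrite pochhammer_gt0 //; lra.
have q_gt0 : 0 < q by rewrite pochhammer_gt0 //; lra.
field; rewrite !gt_eqF //; lra.
Qed.

(** The summand is (M j - L j) / 2 with L (j + 1) = M j, which leaves (M n - L 0) / 2. The factor (n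
    - x)^2 at j = n and the factor x^2 at j = 0 are both e^2. *)
Lemma telescope k e : -1 < e < 1 ->
  \sum_(j < n.+1) ((n%:R - k%:R) ^+ 2 * dougall_term k j e
                   - dougall_term k.+1 j e) =
  e ^+ 2 * (((e - k%:R) * (weight n e ^+ 3 * newton R n%:R k (n%:R - e))
    + (e + k%:R) * (weight 0 e ^+ 3 * newton R n%:R k (0 - e))) / 2).
Proof.
move=> e1.
pose x j : R := j%:R - e.
pose L j := weight j e ^+ 3 * newton R n%:R k (x j) * (x j - k%:R) * x j ^+ 2.
pose M j := weight j e ^+ 3 * newton R n%:R k (x j) * (n%:R - k%:R - x j)
  * (n%:R - x j) ^+ 2.
(* weight j e ^+ 3 is n!^3 times the cube of 1 / (x! (n - x)!) up to a factor
   independent of j, so shifting j by one trades x + 1 for n - x. *)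
have LM j : (j < n)%N -> L j.+1 = M j.
  move=> lt_jn; rewrite /L /M.
  have xS : x j.+1 = x j + 1 by rewrite /x -natr1; ring.
  have := weight_rec _ _ e1 lt_jn; have := newton_shift R n%:R k (x j).
  rewrite xS (_ : _ + 1 - e = x j + 1); last by rewrite /x; ring.
  rewrite (_ : _ - _ + e = n%:R - x j); last by rewrite /x; ring.
  set w' := weight _ _; set w := weight _ _; set p := newton _ _ _ _.
  set q := newton _ _ _ _; move: (x j) => y hp hw.
  (* Shifting the cubed weight takes three factors y + 1: two come from the square in [L], the third
     from [newton_shift]. *)
  transitivity ((w' * (y + 1)) ^+ 2 * w' * (p * (y + 1 - k%:R))); first by ring.
  rewrite hw.
  transitivity (w ^+ 2 * w' * (n%:R - y) * (p * (y + 1 - k%:R) * (n%:R - y))).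
    by ring.
  rewrite hp.
  transitivity (w ^+ 2 * (w' * (y + 1)) * (n%:R - y) * (n%:R - y - k%:R) * q).
    by ring.
  by rewrite hw; ring.
(* With b = x and a = n - x, this rests on a^2 (a - k) - b^2 (b - k) = (a - b) ((n - k)^2 - (a - k)
   (b - k)), where a + b = n. *)
transitivity ((\sum_(j < n.+1) M j - \sum_(j < n.+1) L j) / 2).
  rewrite -sumrB mulr_suml; apply: eq_bigr => j _.
  by rewrite /dougall_term newtonS /M /L /x; field.
rewrite big_ord_recr big_ord_recl /=.
under [X in _ - (_ + X)]eq_bigr do rewrite /bump leq0n add1n LM //.
by rewrite /L /M /x; field.
Qed.

Definition dougall_sum k : R := \sum_(j < n.+1) derive1 (dougall_term k j) 0.

Lemma dougall_sumS k : dougall_sum k.+1 = (n%:R - k%:R) ^+ 2 * dougall_sum k.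
Proof.
have dterm i j := derivable_dougall_term i j.
have dZ (c : R) i j : derivable (fun e => c * dougall_term i j e) 0 1.
  by apply: derivable_fctM => //; exact: derivable_fct_cst.
apply/eqP; rewrite eq_sym -subr_eq0 mulr_sumr -sumrB; apply/eqP.
transitivity (derive1 (fun e => \sum_(j < n.+1)
  ((n%:R - k%:R) ^+ 2 * dougall_term k j e - dougall_term k.+1 j e)) 0).
  rewrite derive1_sum => [|j]; last exact: derivable_fctB.
  apply: eq_bigr => j _; rewrite -derive1_cstM // !derive1E.
  by rewrite -(@deriveB _ _ _ (fun e => (n%:R - k%:R) ^+ 2 * dougall_term k j e)).
rewrite (near0_derive1 _ _ _ (telescope k)) derive1_sqrM //.
have [dw0 dwn] := (derivable_weight 0, derivable_weight n).
have dnewton c : derivable (fun e => newton R n%:R k (c - e)) 0 1.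
  by apply: derivable_newton; derivable_arith.
derivable_arith; exact: dnewton.
Qed.

(** The factor i = j reduces to a e; in [h] it is replaced by a and a dummy 1. The sign a lets the
    lemma serve both x and n - x. *)
Lemma prod_root (a : R) j : (j < n)%N ->
  exists2 h : R -> R, derivable h 0 1 &
    forall e, \prod_(i < n) (j%:R + a * e - i%:R) = e * h e.
Proof.
move=> lt_jn; exists (fun e => a * \prod_(i < n)
    (if i != Ordinal lt_jn then j%:R + a * e - i%:R else 1)).
  apply: derivable_fctM; first exact: derivable_fct_cst.
  apply: derivable_prod_ord => i.
  by case: (i != _); derivable_arith.
move=> e; rewrite (bigD1 (Ordinal lt_jn)) //= -[in RHS]big_mkcond /=.
by rewrite addrAC subrr add0r [a * e]mulrC mulrA.
Qed.

(** Both halves of the Newton product vanish at e = 0, through the factors i = j and i = n - j, so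
    the zero is double. *)
Lemma dougall_term_middle j : (0 < j < n)%N -> derive1 (dougall_term n j) 0 = 0.
Proof.
move=> /andP[j_gt0 lt_jn].
have [f df fE] := prod_root (-1) j lt_jn.
have [g dg gE] : exists2 h : R -> R, derivable h 0 1 &
    forall e, \prod_(i < n) ((n - j)%:R + 1 * e - i%:R) = e * h e.
  by apply: prod_root; rewrite ltn_subrL j_gt0 (ltn_trans j_gt0).
rewrite (_ : dougall_term n j = fun e => e ^+ 2 *
    ((n%:R / 2 - j%:R + e) * weight j e ^+ 3 * (f e * g e))); last first.
  apply/funext => e; rewrite /dougall_term /newton big_split /=.
  have -> : \prod_(i < n) (j%:R - e - i%:R) = e * f e.
    by rewrite -fE; apply: eq_bigr => i _; ring.
  have -> : \prod_(i < n) (n%:R - (j%:R - e) - i%:R) = e * g e.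
    by rewrite -gE; apply: eq_bigr => i _; rewrite natrB ?(ltnW lt_jn) //; ring.
  by ring.
apply: derive1_sqrM.
by have dw := derivable_weight j; derivable_arith.
Qed.

Lemma weight0_end j : (j == 0)%N || (j == n) -> weight j 0 = 1.
Proof.
have nf : n`!%:R != 0 :> R by rewrite pnatr_eq0 -lt0n fact_gt0.
rewrite /weight subr0 addr0 !pochhammer1.
by case/orP => /eqP->; rewrite ?subn0 ?subnn fact0 ?mulr1 ?mul1r divff.
Qed.

(** At an end only one half of the Newton product vanishes, so the zero is simple. The sign a treats
    both ends at once: a = -1 for j = 0 and a = 1 for j = n. *)
Lemma dougall_term_end j (a : R) : (0 < n)%N ->
  a ^+ 2 = 1 -> (j == 0)%N || (j == n) -> n%:R / 2 - j%:R = - a * n%:R / 2 ->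
  (forall e, newton R n%:R n (j%:R - e) = newton R n%:R n (a * e)) ->
  derive1 (dougall_term n j) 0 = (-1) ^+ n * n`!%:R ^+ 2 / 2.
Proof.
move=> n_gt0 a2 jend jE newtonE.
have [m def_n] : exists m, n = m.+1 by exists n.-1; rewrite prednK.
(* Cofactor of e in the Newton product, once the factor i = 0 of the first half, a e, is split
   off. *)
pose v e : R := a * (\prod_(i < m) (a * e + (- 1 - i%:R)) *
  \prod_(i < n) (- a * e + (n%:R - i%:R))).
have newtonM e : newton R n%:R n (a * e) = e * v e.
  rewrite /newton big_split /=.
  have -> : \prod_(i < n) (a * e - i%:R) =
            a * e * \prod_(i < m) (a * e + (- 1 - i%:R)).
    rewrite def_n big_ord_recl subr0; congr (_ * _).
    by apply: eq_bigr => i _; rewrite lift0 -natr1; ring.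
  have -> : \prod_(i < n) (n%:R - a * e - i%:R) =
            \prod_(i < n) (- a * e + (n%:R - i%:R)).
    by apply: eq_bigr => i _; ring.
  by rewrite /v; ring.
have dv : derivable v 0 1 by rewrite /v; derivable_arith.
have v0 : v 0 = a * ((-1) ^+ m * m`!%:R * n`!%:R).
  rewrite /v; congr (a * (_ * _)).
    rewrite (eq_bigr (fun i : 'I_m => -1 * (1 + i%:R))); last by move=> i _; ring.
    by rewrite big_split /= prodr_const card_ord -pochhammer1.
  rewrite -[RHS](pochhammer1 R) /pochhammer (reindex_inj rev_ord_inj) /=.
  by apply: eq_bigr => i _; rewrite natrB // -natr1; ring.
rewrite (_ : dougall_term n j = fun e => e *
    ((n%:R / 2 - j%:R + e) * weight j e ^+ 3 * v e)); last first.
  by apply/funext => e; rewrite /dougall_term newtonE newtonM; ring.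
rewrite derive1_idM.
  rewrite v0 weight0_end // addr0 jE.
  rewrite def_n factS natrM [(-1) ^+ m.+1]exprS.
  (* The sign enters twice, through n / 2 - j and through [v], so the two ends contribute
     equally. *)
  transitivity (- (a ^+ 2) * m.+1%:R / 2 *
    ((-1) ^+ m * m`!%:R * (m.+1%:R * m`!%:R)) : R).
    by rewrite -natrM -factS; field.
  by rewrite a2; field.
by have dw := derivable_weight j; derivable_arith.
Qed.

Lemma dougall_sum_n : (0 < n)%N -> dougall_sum n = (-1) ^+ n * n`!%:R ^+ 2.
Proof.
move=> n_gt0.
rewrite /dougall_sum -(big_mkord xpredT (fun j => derive1 (dougall_term n j) 0)).
rewrite big_nat_recr //= big_ltn // big_nat_cond big1 => [|j]; last first.
  by rewrite andbT => /dougall_term_middle.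
rewrite addr0.
rewrite (dougall_term_end 0 (-1)) ?(dougall_term_end n 1) ?eqxx ?orbT //.
- by field.
- by rewrite expr1n.
- by field.
- by move=> e; rewrite newton_refl mul1r.
- by rewrite sqrrN expr1n.
- by field.
- by move=> e; congr newton; ring.
Qed.

Lemma dougall_sumE k : (0 < n)%N -> (k <= n)%N ->
  dougall_sum k = (-1) ^+ n * (n`!%:R / (n - k)`!%:R) ^+ 2.
Proof.
move=> n_gt0 le_kn; rewrite -{1}(subKn le_kn).
(* Descending induction from k = n: [dougall_sumS] is solved for the sum at the smaller index by
   dividing by the nonzero (d + 1)^2. *)
elim: (n - k)%N (leq_subr k n) => [|d IH] lt_dn.
  by rewrite subn0 fact0 divr1 dougall_sum_n.
have d_neq0 : d.+1%:R != 0 :> R by rewrite pnatr_eq0.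
have fact_neq0 : d`!%:R != 0 :> R by rewrite pnatr_eq0 -lt0n fact_gt0.
apply: (@mulfI _ (d.+1%:R ^+ 2)); first by rewrite expf_neq0.
have := dougall_sumS (n - d.+1); rewrite -subSn // subSS IH 1?ltnW //.
rewrite natrB // opprB addrCA subrr addr0 => <-.
by rewrite factS natrM; field; rewrite fact_neq0 nat1r.
Qed.

(** * Derivative-free form of a_n and integrality of its terms *)

Definition newton_coef k : R :=
  'C(n, k)%:R * pochhammer (1 / 2 + k%:R) (n - k)
    * pochhammer (n%:R + 1 / 2) (n - k) / n`!%:R ^+ 2.

(** With x = j - e the two binomials are (x + 1/2)_n / n! and (n - x + 1/2)_n / n!; their product is
    expanded by [pochhammer_newton] with N = m = n and s = 1/2. *)
Lemma catalan_term_dougall j e :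
  catalan_term n j e = \sum_(k < n.+1) newton_coef k * dougall_term k j e.
Proof.
rewrite /catalan_term (_ : _ - e - _ = (j%:R - e + 1 / 2) + n%:R - 1); last first.
  by field.
rewrite (_ : _ + e - 1 / 2 = (n%:R - (j%:R - e) + 1 / 2) + n%:R - 1); last first.
  by field.
rewrite !gbinom_pochhammer -/(weight j e).
transitivity ((n%:R / 2 - j%:R + e) * weight j e ^+ 3 / n`!%:R ^+ 2 *
   (pochhammer (j%:R - e + 1 / 2) n * pochhammer (n%:R - (j%:R - e) + 1 / 2) n)).
  by rewrite [n`!%:R ^+ 2]expr2 invfM; ring.
rewrite pochhammer_newton mulr_sumr; apply: eq_bigr => k _.
by rewrite /newton_coef /dougall_term; ring.
Qed.

Lemma catalan_aE : (0 < n)%N -> catalan_a R n =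
  - (4 * \sum_(k < n.+1) newton_coef k * (n`!%:R / (n - k)`!%:R) ^+ 2).
Proof.
move=> n_gt0; rewrite /catalan_a.
transitivity (4 * (-1) ^+ n.-1 * \sum_(k < n.+1) newton_coef k * dougall_sum k).
  congr (_ * _); under [RHS]eq_bigr do rewrite mulr_sumr.
  rewrite exchange_big; apply: eq_bigr => j _ /=.
  have dterm k := derivable_dougall_term k j.
  rewrite (_ : catalan_term n j = fun e =>
      \sum_(k < n.+1) newton_coef k * dougall_term k j e); last first.
    by apply/funext => e; rewrite catalan_term_dougall.
  rewrite derive1_sum => [|k]; last first.
    by apply: derivable_fctM => //; exact: derivable_fct_cst.
  by apply: eq_bigr => k _; rewrite derive1_cstM.
rewrite -mulrN -mulrA; congr (4 * _).
rewrite mulr_sumr -sumrN; apply: eq_bigr => k _.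
have signE : (-1) ^+ n = - (-1) ^+ n.-1 :> R.
  by rewrite -[in LHS](prednK n_gt0) exprS mulN1r.
rewrite dougall_sumE ?leq_ord // signE.
transitivity (- ((-1) ^+ n.-1 * (-1) ^+ n.-1) *
  (newton_coef k * (n`!%:R / (n - k)`!%:R) ^+ 2)).
  by ring.
by rewrite -expr2 sqrr_sign mulN1r.
Qed.

(** With m = n - k, the symbols (k + 1/2)_m and (n + 1/2)_m join into (k + 1/2)_(2m). Then 1 / m!^2
    = C(2m, m) / (2m)! and 2^(4n) = 16^k 4^(2m) bring in [pochhammer_half_int]. *)
Lemma newton_coef_int k : (k <= n)%N ->
  2 ^+ (4 * n) * (newton_coef k * (n`!%:R / (n - k)`!%:R) ^+ 2) \is a Num.int.
Proof.
have fact_neq0 i : i`!%:R != 0 :> R by rewrite pnatr_eq0 -lt0n fact_gt0.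
move=> le_kn; rewrite /newton_coef; set m := (n - k)%N.
have nE : n = (k + m)%N by rewrite subnKC.
suff -> : 2 ^+ (4 * n) * ('C(n, k)%:R * pochhammer (1 / 2 + k%:R) m
    * pochhammer (n%:R + 1 / 2) m / n`!%:R ^+ 2 * (n`!%:R / m`!%:R) ^+ 2) =
  16 ^+ k * 'C(n, k)%:R * 'C(m + m, m)%:R *
  (4 ^+ (m + m) * pochhammer (k%:R + 1 / 2) (m + m) / (m + m)`!%:R) :> R.
  apply: rpredM; last exact: pochhammer_half_int.
  by rewrite !rpredM ?rpredX ?natr_int.
rewrite pochhammerD [1 / 2 + _]addrC [_ + 1 / 2 + m%:R]addrAC -natrD -nE.
have -> : (m + m)`!%:R = 'C(m + m, m)%:R * m`!%:R ^+ 2 :> R.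
  by rewrite expr2 -!natrM -[in LHS](bin_fact (leq_addr m m)) addnK.
have -> : 2 ^+ (4 * n) = 16 ^+ k * 4 ^+ (m + m) :> R.
  rewrite nE mulnDr exprD exprM addnn -mul2n exprM mulnC.
  by rewrite -natrX mulnC exprM -!natrX.
have C_neq0 : 'C(m + m, m)%:R != 0 :> R.
  by rewrite pnatr_eq0 -lt0n bin_gt0 leq_addr.
by field; rewrite C_neq0 !fact_neq0.
Qed.

End DougallSum.

Theorem theorem1 (R : realType) (n : nat) (n_gt0 : (0 < n)%N) :
  2 ^+ (4 * n) * catalan_a R n \is a Num.int.
Proof.
rewrite catalan_aE // mulrN rpredN mulrCA rpredM ?natr_int //.
rewrite mulr_sumr rpred_sum // => k _; exact/newton_coef_int/leq_ord.
Qed.
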